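(* For every positive integer $n$ there is a simple closed curve $\gamma \subset \mathbb{R}^2$ which has exactly $n$ inscribed squares. Moreover, $\gamma$ can be taken to be infinitely differentiable and convex.
   Context: A simple closed curve in the plane is the image of an injective continuous map from the circle $S^1$ to $\mathbb{R}^2$. A square is inscribed in a simple closed curve $\gamma$ if its four vertices all belong to $\gamma$; it is not required that the square be contained in the region bounded by $\gamma$. Squares are non-degenerate (positive side length), and inscribed squares are counted as geometric figures, i.e. by their sets of four vertices (no labelling of vertices). The curve is convex if the bounded region it encloses is convex. The curve is infinitely differentiable if it is the image of an injective $C^\infty$ map $S^1 \to \mathbb{R}^2$ with nowhere vanishing derivative (so that, in particular, it has no corners). *)

(* Defs.v *)
From HB Require Import structures.
From mathcomp Require Import all_boot all_order all_algebra.
From mathcomp Require Import all_classical all_reals all_analysis.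

Set Implicit Arguments.
Unset Strict Implicit.
Unset Printing Implicit Defensive.

Import Order.TTheory GRing.Theory Num.Theory.
Import numFieldNormedType.Exports.

Local Open Scope ring_scope.
Local Open Scope classical_set_scope.

(* The plane is [R * R]. Its library norm is the sup norm, which induces the
   usual topology and the usual bounded sets; Euclidean lengths and angles are
   always expressed through [dotp]. *)
Definition dotp (R : realType) (u v : R * R) : R := u.1 * v.1 + u.2 * v.2.

Definition unit_circle (R : realType) : set (R * R) :=
  [set p | p.1 ^+ 2 + p.2 ^+ 2 = 1].
Arguments unit_circle : clear implicits.

(* A map defined on the circle is given by a total function on the plane, of
   which only the values on [unit_circle R] matter. *)
Definition simple_closed_curve (R : realType) (gamma : set (R * R)) : Prop :=
  exists f : R * R -> R * R,
    [/\ {within unit_circle R, continuous f},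
        set_inj (unit_circle R) f &
        gamma = f @` unit_circle R].

(* The map [f] on the circle, read in the angular coordinate. Since
   [t |-> (cos t, sin t)] is a smooth covering of the circle with unit speed,
   [f] is smooth on the circle iff [angular f] is smooth on the line, and its
   derivative along the circle is the derivative of [angular f]. *)
Definition angular (R : realType) (f : R * R -> R * R) : R -> R * R :=
  fun t => f (cos t, sin t).

Definition smooth_curve (R : realType) (gamma : set (R * R)) : Prop :=
  exists f : R * R -> R * R,
    [/\ forall (k : nat) (t : R), derivable (derive1n k (angular f)) t 1,
        forall t : R, derive1 (angular f) t != 0,
        set_inj (unit_circle R) f &
        gamma = f @` unit_circle R].

(* The union of the bounded connected components of the complement; for a
   simple closed curve there is exactly one such component, by the Jordan curve
   theorem. *)
Definition enclosed_region (R : realType) (gamma : set (R * R)) :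
    set (R * R) :=
  [set p | (~` gamma) p /\ bounded_set (connected_component (~` gamma) p)].

Definition convex_curve (R : realType) (gamma : set (R * R)) : Prop :=
  convex_set (enclosed_region gamma).

(* [Q] is the set of vertices of a square [abcd] (in cyclic order): a
   parallelogram with two orthogonal adjacent sides of equal positive length. *)
Definition square (R : realType) (Q : set (R * R)) : Prop :=
  exists a b c d : R * R,
    [/\ Q = [set a; b; c; d],
        b - a = c - d,
        dotp (b - a) (d - a) = 0,
        dotp (b - a) (b - a) = dotp (d - a) (d - a) &
        0 < dotp (b - a) (b - a)].

Definition inscribed_squares (R : realType) (gamma : set (R * R)) :
    set (set (R * R)) :=
  [set Q | square Q /\ Q `<=` gamma].

(* Main.v *)
Require Import Defs.
From mathcomp Require Import all_boot all_order all_algebra.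
From mathcomp Require Import all_classical all_reals all_analysis.
From mathcomp Require Import ring lra.

Set Implicit Arguments.
Unset Strict Implicit.
Unset Printing Implicit Defensive.

Import Order.TTheory GRing.Theory Num.Theory.
Import numFieldNormedType.Exports.

Local Open Scope ring_scope.
Local Open Scope classical_set_scope.
Local Open Scope card_scope.

(** The curve is the unit circle, slightly dented inwards in the open first
quadrant in such a way that the quarter of circle from (1,0) to (0,1) is still
touched at exactly the n heights i/n, 0 <= i < n, besides its endpoint (0,1).
It is the unit level set of a function N, positively homogeneous and
subadditive, which is at least the Euclidean norm and equal to it outside the
open first quadrant.

Why there are exactly n squares. The key point is that a square inscribed in
such a curve has all its vertices on the unit circle. A vertex off the circle
lies inside the disc, in the open first quadrant, where two points of the curve
are never comparable coordinatewise ([gauge_curve_antitone]): all chords there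
have negative slope, so no two of them are orthogonal, and at most two vertices
are off the circle.  One vertex cannot be off alone, as the other three
determine the circle.  If two opposite vertices are off, the other two are at
equal distance from the origin, so that the off diagonal lies on a line through
the origin, a chord of positive slope ([diagonal_not_off]).  If two adjacent
vertices a and b are off, the side cd is a chord of the circle: either the
square sits outwards on ab, and then c and d also are in the first quadrant, or
ab is seen from the origin under an obtuse angle, whereas a quadrant only sees
acute ones ([side_not_off]).  A square inscribed in the unit circle is invariant
under the quarter turn, hence has exactly one vertex with x > 0 and y >= 0, its
other vertices are outside the open quadrant and thus always on the curve, and
the inscribed squares correspond to the points of contact with x > 0 and y >= 0
([inscribed_squaresE]).

Why the curve is smooth and convex. In polar coordinates N is r k(t) where
k = 1 + e h, with h a smooth function obtained from the flat function
exp(-1/x).  Such an N is subadditive as soon as k + k'' >= 0 (this is the sign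
of the curvature), by the Sturm-type argument of [tangent_line_le]; that holds
when e is small since h + h'' is bounded on compact intervals.  The region
enclosed by the curve is N < 1, which is convex because N is subadditive. *)

(** * Planar norms flat outside the first quadrant *)

Definition enorm (R : realType) (p : R * R) : R := Num.sqrt (dotp p p).

(** [N] is the Minkowski functional of a convex body contained in the unit disc
and having the same boundary as the disc outside the open first quadrant. *)
Definition gauge (R : realType) (N : R * R -> R) : Prop :=
  [/\ forall t p, 0 <= t -> N (t *: p) = t * N p,
      forall p q, N (p + q) <= N p + N q,
      forall p, enorm p <= N p &
      forall p, ~ (0 < p.1 /\ 0 < p.2) -> N p = enorm p].

Definition gauge_curve (R : realType) (N : R * R -> R) : set (R * R) :=
  [set p | N p = 1].

Section Dotp.
Variable R : realType.
Implicit Types p : R * R.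

Lemma scale_pairE t p : t *: p = (t * p.1, t * p.2).
Proof. by []. Qed.

Lemma dotp_ge0 p : 0 <= dotp p p.
Proof. by rewrite /dotp; nra. Qed.

Lemma enorm_sqr p : enorm p ^+ 2 = dotp p p.
Proof. by rewrite sqr_sqrtr // dotp_ge0. Qed.

Lemma enorm_ge0 p : 0 <= enorm p.
Proof. exact: sqrtr_ge0. Qed.

Lemma enormZ t p : 0 <= t -> enorm (t *: p) = t * enorm p.
Proof.
move=> t0; rewrite /enorm.
have -> : dotp (t *: p) (t *: p) = t ^+ 2 * dotp p p.
  by rewrite scale_pairE /dotp /=; ring.
by rewrite sqrtrM ?sqr_ge0 // sqrtr_sqr ger0_norm.
Qed.

Lemma enorm_eq1 p : enorm p = 1 <-> dotp p p = 1.
Proof.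
split=> [h|h]; first by rewrite -enorm_sqr h expr1n.
by rewrite /enorm h sqrtr1.
Qed.

End Dotp.

(** * Squares with a vertex off the unit circle *)

Definition square_vertices (R : realType) (a b c d : R * R) : Prop :=
  [/\ b - a = c - d, dotp (b - a) (d - a) = 0,
      dotp (b - a) (b - a) = dotp (d - a) (d - a) & 0 < dotp (b - a) (b - a)].

Section SquareVertices.
Variable R : realType.
Implicit Types a b c d : R * R.

(** Two orthogonal vectors of equal length in the plane differ by a quarter
turn; [s] is its sign, that is the orientation of the square. *)
Lemma square_verticesP a b c d : square_vertices a b c d ->
  exists w1 w2 s, [/\ s ^+ 2 = 1, 0 < w1 ^+ 2 + w2 ^+ 2,
    b = (a.1 + w1, a.2 + w2), d = (a.1 - s * w2, a.2 + s * w1) &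
    c = (a.1 + w1 - s * w2, a.2 + w2 + s * w1)].
Proof.
case: a b c d => [a1 a2] [b1 b2] [c1 c2] [d1 d2] [].
rewrite /dotp /= => -[e1 e2] orth len pos.
set w1 := b1 - a1 in e1 orth len pos *.
set w2 := b2 - a2 in e2 orth len pos *.
set z1 := d1 - a1 in orth len *.
set z2 := d2 - a2 in orth len *.
have n0 : w1 * w1 + w2 * w2 != 0 by rewrite gt_eqF.
set s := (w1 * z2 - w2 * z1) / (w1 * w1 + w2 * w2).
have z1E : z1 = - (s * w2).
  apply: (mulIf n0); rewrite mulNr mulrAC /s divfK //.
  have -> : z1 * (w1 * w1 + w2 * w2) =
    w1 * (w1 * z1 + w2 * z2) - (w1 * z2 - w2 * z1) * w2 by ring.
  by rewrite orth mulr0 sub0r.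
have z2E : z2 = s * w1.
  apply: (mulIf n0); rewrite mulrAC /s divfK //.
  have -> : z2 * (w1 * w1 + w2 * w2) =
    w2 * (w1 * z1 + w2 * z2) + (w1 * z2 - w2 * z1) * w1 by ring.
  by rewrite orth mulr0 add0r.
exists w1, w2, s; split.
- have : (s ^+ 2 - 1) * (w1 * w1 + w2 * w2) = 0.
    have -> : (s ^+ 2 - 1) * (w1 * w1 + w2 * w2) =
      (- (s * w2)) * (- (s * w2)) + (s * w1) * (s * w1)
      - (w1 * w1 + w2 * w2) by ring.
    by rewrite -z1E -z2E -len subrr.
  by move/eqP; rewrite mulf_eq0 (negbTE n0) orbF subr_eq0 => /eqP.
- by rewrite !expr2.
- by congr pair; rewrite /w1 /w2; ring.
- by congr pair; rewrite -?z2E ?/z2 -?z1E /z1; ring.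
- move: e1 e2; rewrite -z2E -addrA -z1E /z1 /z2 => e1 e2.
  by congr pair; lra.
Qed.

Lemma square_vertices_rot a b c d :
  square_vertices a b c d -> square_vertices b c d a.
Proof.
move/square_verticesP => [w1 [w2 [s [s1 pos -> -> ->]]]].
have e : (s * w1) * (s * w1) + (s * w2) * (s * w2) = w1 ^+ 2 + w2 ^+ 2.
  rewrite -[RHS]mul1r -s1; ring.
split; rewrite /dotp /=; [congr pair => /=; ring | ring | |].
- transitivity ((s * w1) * (s * w1) + (s * w2) * (s * w2)); first by ring.
  by rewrite e; ring.
- by move: pos; rewrite -e; congr (_ < _); ring.
Qed.

End SquareVertices.

Section GaugeCurve.
Variables (R : realType) (N : R * R -> R).
Hypothesis gN : gauge N.
Let gamma := gauge_curve N.
Implicit Types a b c d p q : R * R.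

Lemma gauge_curve_le1 p : gamma p -> dotp p p <= 1.
Proof.
case: gN => _ _ h _; rewrite /gamma /gauge_curve /= => Np.
have := h p; rewrite Np => np1; rewrite -enorm_sqr.
by rewrite expr_le1 // enorm_ge0.
Qed.

Lemma gauge_curve_off p : gamma p -> dotp p p <> 1 ->
  [/\ 0 < p.1, 0 < p.2 & dotp p p < 1].
Proof.
move=> gp np.
have lt1 : dotp p p < 1.
  by have := gauge_curve_le1 gp; rewrite le_eqVlt => /orP[/eqP//|].
have [[h1 h2]//|h] := pselect (0 < p.1 /\ 0 < p.2).
case: gN => _ _ _ /(_ _ h); rewrite /gamma /gauge_curve /= in gp *.
by rewrite gp => /esym/enorm_eq1.
Qed.

Lemma gauge_axis t : 0 <= t -> N (t, 0) = t /\ N (0, t) = t.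
Proof.
move=> t0; case: gN => _ _ _ h; split.
- rewrite h /=; last by case; rewrite ltxx.
  by rewrite /enorm /dotp /= mulr0 addr0 -expr2 sqrtr_sqr ger0_norm.
- rewrite h /=; last by case; rewrite ltxx.
  by rewrite /enorm /dotp /= mulr0 add0r -expr2 sqrtr_sqr ger0_norm.
Qed.

(** The body contains [q], (1,0), (0,1) and the origin. A point below [q] lies in
their convex hull, and is on the boundary of the body only if it is [q]: the
possible extreme cases are excluded because [q] is in the unit disc. *)
Lemma gauge_curve_antitone p q : gamma p -> gamma q ->
  0 <= p.1 -> 0 <= p.2 -> p.1 <= q.1 -> p.2 <= q.2 -> p = q.
Proof.
case: p q => [p1 p2] [q1 q2] /= gp gq p10 p20 pq1 pq2.
have := gauge_curve_le1 gq; rewrite /dotp /= => q_le1.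
case: (gN) => homN subN _ _.
have q1_le1 : q1 <= 1 by nra.
have q2_le1 : q2 <= 1 by nra.
have Np : N (p1, p2) = 1 := gp.
have Nq : N (q1, q2) = 1 := gq.
(* [p] is a nonnegative combination of [q] and of one of the unit vectors *)
have key1 l s : 0 <= l -> 0 <= s -> p1 = l * q1 + s -> p2 = l * q2 -> 1 <= l + s.
  move=> l0 s0 e1 e2; rewrite -Np.
  have -> : (p1, p2) = l *: (q1, q2) + (s, 0).
    by rewrite e1 e2; congr pair; rewrite /= ?addr0 ?add0r.
  by apply: le_trans (subN _ _) _; rewrite homN // Nq mulr1 (gauge_axis s0).1.
have key2 l s : 0 <= l -> 0 <= s -> p1 = l * q1 -> p2 = l * q2 + s -> 1 <= l + s.
  move=> l0 s0 e1 e2; rewrite -Np.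
  have -> : (p1, p2) = l *: (q1, q2) + (0, s).
    by rewrite e1 e2; congr pair; rewrite /= ?addr0 ?add0r.
  by apply: le_trans (subN _ _) _; rewrite homN // Nq mulr1 (gauge_axis s0).2.
have Ne0 : N (0, 0) = 0 by have [] := gauge_axis (lexx 0).
have [q10|q1n0] := eqVneq q1 0.
  have e1 : p1 = 0 by lra.
  have := (gauge_axis p20).2; rewrite -{1}e1 Np => p21.
  by congr pair; lra.
have [q20|q2n0] := eqVneq q2 0.
  have e1 : p2 = 0 by lra.
  have := (gauge_axis p10).1; rewrite -{1}e1 Np => p11.
  by congr pair; lra.
have q1p : 0 < q1 by rewrite lt0r q1n0; lra.
have q2p : 0 < q2 by rewrite lt0r q2n0; lra.
have q1_lt1 : q1 < 1 by nra.
have q2_lt1 : q2 < 1 by nra.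
have [le12|lt12] := leP (p2 / q2) (p1 / q1).
- set l := p2 / q2.
  have e2 : p2 = l * q2 by rewrite /l divfK.
  have l0 : 0 <= l by rewrite divr_ge0 // ltW.
  have ls : l * q1 <= p1 by rewrite -ler_pdivlMr.
  have l1 : l <= 1 by rewrite ler_pdivrMr // mul1r.
  have := key1 l (p1 - l * q1) l0 _ _ e2.
  rewrite subr_ge0 ls addrC subrK => /(_ isT erefl) h.
  have : l = 1 by nra.
  by move=> le; move: e2 ls h; rewrite le => *; congr pair; lra.
- set l := p1 / q1.
  have e2 : p1 = l * q1 by rewrite /l divfK.
  have l0 : 0 <= l by rewrite divr_ge0 // ltW.
  have ls : l * q2 <= p2 by rewrite -ler_pdivlMr // ltW.
  have l1 : l <= 1 by rewrite ler_pdivrMr // mul1r.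
  have := key2 l (p2 - l * q2) l0 _ e2.
  rewrite subr_ge0 ls addrC subrK => /(_ isT erefl) h.
  have : l = 1 by nra.
  by move=> le; move: e2 ls h; rewrite le => *; congr pair; lra.
Qed.

Lemma gauge_curve_chord p q : gamma p -> gamma q -> p <> q ->
  0 <= p.1 -> 0 <= p.2 -> 0 <= q.1 -> 0 <= q.2 ->
  (p.1 - q.1) * (p.2 - q.2) < 0.
Proof.
move=> gp gq npq p1 p2 q1 q2; rewrite ltNge; apply/negP => h.
have [h1|h1] := leP p.1 q.1; have [h2|h2] := leP p.2 q.2.
- exact/npq/gauge_curve_antitone.
- have : p.1 = q.1 by nra.
  by move=> e; apply/npq/esym/gauge_curve_antitone => //; rewrite ?e // ltW.
- have : p.2 = q.2 by nra.
  by move=> e; apply/npq/esym/gauge_curve_antitone => //; rewrite ?e // ltW.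
- by apply/npq/esym/gauge_curve_antitone => //; rewrite ltW.
Qed.

(** Two vectors of negative slope cannot be orthogonal: the two terms of their
scalar product have the same sign. *)
Lemma no_right_angle_in_quadrant p q r : gamma p -> gamma q -> gamma r ->
  p <> q -> r <> q ->
  0 <= p.1 -> 0 <= p.2 -> 0 <= q.1 -> 0 <= q.2 -> 0 <= r.1 -> 0 <= r.2 ->
  dotp (p - q) (r - q) <> 0.
Proof.
move=> gp gq gr pq rq p1 p2 q1 q2 r1 r2.
have := gauge_curve_chord gp gq pq p1 p2 q1 q2.
have := gauge_curve_chord gr gq rq r1 r2 q1 q2.
rewrite /dotp /=.
move: (p.1 - q.1) (p.2 - q.2) (r.1 - q.1) (r.2 - q.2) => u1 u2 v1 v2 hv hu huv.
have e : u1 * v1 = - (u2 * v2) by lra.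
have : 0 < (u1 * u2) * (v1 * v2) by rewrite nmulr_rgt0.
have -> : (u1 * u2) * (v1 * v2) = (u1 * v1) * (u2 * v2) by ring.
by rewrite e mulNr oppr_gt0 ltNge -expr2 sqr_ge0.
Qed.


Lemma corner_not_in_quadrant a b c d : square_vertices a b c d ->
  gamma a -> gamma b -> gamma d -> 0 <= a.1 -> 0 <= a.2 -> 0 <= b.1 ->
  0 <= b.2 -> 0 <= d.1 -> 0 <= d.2 -> False.
Proof.
move=> sq ga gb gd a1 a2 b1 b2 d1 d2; case: sq => _ orth len pos.
apply: (no_right_angle_in_quadrant gb ga gd) orth => // e.
- by move: pos; rewrite e subrr /dotp /= mulr0 addr0 ltxx.
- by move: pos; rewrite len e subrr /dotp /= mulr0 addr0 ltxx.
Qed.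

(** Since [b] and [d] are at the same distance from the origin, the line [ac] is
the perpendicular bisector of [bd] and contains the origin; but two points of
the open quadrant collinear with the origin are joined by a chord of positive
slope. *)
Lemma diagonal_not_off a b c d : square_vertices a b c d ->
  gamma a -> gamma b -> gamma c -> gamma d ->
  dotp a a <> 1 -> dotp c c <> 1 -> dotp b b = 1 -> dotp d d = 1 -> False.
Proof.
move=> sq ga gb gc gd offa offc onb ond.
have [a1 a2 _] := gauge_curve_off ga offa.
have [c1 c2 _] := gauge_curve_off gc offc.
have ac : a <> c.
  move=> e; move/square_verticesP: sq => [w1 [w2 [s [s1 pos _ _]]]].
  rewrite -e => -/(congr1 (fun p => p)) h.
  have := congr1 fst h; have := congr1 snd h => /= h2 h1.
  have : w1 = s * w2 by lra.
  have : w2 = - (s * w1) by lra.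
  by nra.
have chord := gauge_curve_chord ga gc ac (ltW a1) (ltW a2) (ltW c1) (ltW c2).
move/square_verticesP: sq => [w1 [w2 [s [s1 pos bE dE cE]]]].
(* The relation [h] says that [a] is orthogonal to the diagonal [bd]; after a
   quarter turn, it says that [a] is parallel to the diagonal [ac]. *)
have cross : a.1 * c.2 = a.2 * c.1.
  move: onb ond; rewrite bE dE cE /dotp /= => onb ond.
  have h : a.1 * (w1 + s * w2) + a.2 * (w2 - s * w1) = 0.
    have e : (s * w1) * (s * w1) + (s * w2) * (s * w2) = w1 ^+ 2 + w2 ^+ 2.
      by rewrite -[RHS]mul1r -s1; ring.
    by nra.
  have : s * (a.1 * (a.2 + w2 + s * w1) - a.2 * (a.1 + w1 - s * w2)) = 0.
    transitivity (a.1 * (s ^+ 2 * w1 + s * w2) + a.2 * (s ^+ 2 * w2 - s * w1));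
      first by ring.
    by rewrite s1 !mul1r.
  have s0 : s != 0 by rewrite -sqrf_eq0 s1 oner_eq0.
  by move/eqP; rewrite mulf_eq0 (negbTE s0) /= subr_eq0 => /eqP.
have e : c.1 * (a.2 - c.2) = c.2 * (a.1 - c.1) by lra.
have [h|h] := leP a.1 c.1.
  have h2 : 0 < a.2 - c.2 by nra.
  have := mulr_gt0 c1 h2; rewrite e; nra.
have h2 : a.2 - c.2 < 0 by nra.
have : 0 < c.2 * (a.1 - c.1) by rewrite mulr_gt0 // subr_gt0.
by rewrite -e; nra.
Qed.

(** The side [ab] has negative slope, so the vector [v] from [a] to [d] has both
coordinates of the same sign. If they are positive, then [d] is a third vertex
in the quadrant. If they are negative, the circle being crossed between [a] and
[d] forces the scalar product of [a] and [b] to be negative, which is impossible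
in the first quadrant. *)
Lemma side_not_off a b c d : square_vertices a b c d ->
  gamma a -> gamma b -> gamma c -> gamma d ->
  dotp a a <> 1 -> dotp b b <> 1 -> dotp c c = 1 -> dotp d d = 1 -> False.
Proof.
move=> sq ga gb gc gd offa offb onc ond.
have [a1 a2 a_lt1] := gauge_curve_off ga offa.
have [b1 b2 b_lt1] := gauge_curve_off gb offb.
have ab : a <> b.
  case: sq => _ _ _ pos e; move: pos.
  by rewrite e subrr /dotp /= mulr0 addr0 ltxx.
have chord := gauge_curve_chord ga gb ab (ltW a1) (ltW a2) (ltW b1) (ltW b2).
have corner := corner_not_in_quadrant sq ga gb gd (ltW a1) (ltW a2)
  (ltW b1) (ltW b2).
move/square_verticesP: sq => [w1 [w2 [s [s1 pos bE dE cE]]]].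
have w12 : w1 * w2 < 0 by move: chord; rewrite bE /=; nra.
move: corner onc ond b1 b2 b_lt1; rewrite bE dE cE /dotp /= {bE dE cE}.
rewrite /dotp in a_lt1.
set v1 := - (s * w2); set v2 := s * w1.
have v12 : 0 < v1 * v2 by rewrite /v1 /v2; nra.
have orth : w1 * v1 + w2 * v2 = 0 by rewrite /v1 /v2; ring.
have len : v1 * v1 + v2 * v2 = w1 * w1 + w2 * w2.
  have -> : v1 * v1 + v2 * v2 = s ^+ 2 * (w1 * w1 + w2 * w2).
    by rewrite /v1 /v2; ring.
  by rewrite s1 mul1r.
move=> corner onc ond b1 b2 b_lt1.
have [v1p|v1n] := ltP 0 v1.
  have v2p : 0 < v2 by rewrite -(pmulr_rgt0 _ v1p).
  by apply: corner; lra.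
have v2n : v2 < 0 by nra.
have av_lt0 : a.1 * v1 + a.2 * v2 < 0 by nra.
set P := a.1 * a.1 + a.2 * a.2 in a_lt1.
set L := w1 * w1 + w2 * w2 in len.
set X := a.1 * v1 + a.2 * v2 in av_lt0.
(* [c] and [d] are equidistant from the origin, hence so are [a] and [b]. *)
have aw : a.1 * w1 + a.2 * w2 = - L / 2 by rewrite /L; nra.
have vX : 0 < 2 * X + L by rewrite -len /X; rewrite /P in a_lt1; nra.
(* Pythagoras for [a] in the orthogonal frame made of the two sides at [a]; as
   [X] is between [- L / 2] and 0, it bounds [P], the square of the length of [a],
   by [L / 2]. *)
have PL : P * L = (L / 2) ^+ 2 + X ^+ 2.
  have -> : (L / 2) ^+ 2 = (a.1 * w1 + a.2 * w2) ^+ 2 by rewrite aw; ring.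
  rewrite /P /L /X /v1 /v2.
  transitivity ((a.1 * w1 + a.2 * w2) ^+ 2 + s ^+ 2 * (a.1 * w2 - a.2 * w1) ^+ 2);
    last by ring.
  by rewrite s1; ring.
(* [P - L / 2] is the scalar product of [a] and [b]. *)
have ab0 : 0 < P - L / 2 by rewrite -mulNr -aw /P; nra.
by nra.
Qed.

End GaugeCurve.

(** * Squares inscribed in the unit circle *)

Section SquaresOnCircle.
Variable R : realType.
Implicit Types a b c d p q u v : R * R.

Lemma square_fourth_on_circle a b c d : square_vertices a b c d ->
  dotp a a = 1 -> dotp b b = 1 -> dotp d d = 1 -> dotp c c = 1.
Proof.
move/square_verticesP => [w1 [w2 [s [s1 pos -> -> ->]]]].
rewrite /dotp /= => ha hb hd.
transitivity ((a.1 + w1) * (a.1 + w1) + (a.2 + w2) * (a.2 + w2) +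
  ((a.1 - s * w2) * (a.1 - s * w2) + (a.2 + s * w1) * (a.2 + s * w1)) -
  (a.1 * a.1 + a.2 * a.2)); first by ring.
by rewrite ha hb hd addrK.
Qed.

Definition turn p : R * R := (- p.2, p.1).

Definition central_square p : set (R * R) :=
  [set p; turn p; - p; - turn p].

Lemma turnK p : turn (turn p) = - p. Proof. by []. Qed.

Lemma central_squareN p : central_square (- p) = central_square p.
Proof.
rewrite /central_square; have -> : turn (- p) = - turn p by [].
rewrite !opprK; apply/seteqP.
by split=> x /=; rewrite /set1 /=; tauto.
Qed.

Lemma central_square_turn p : central_square (turn p) = central_square p.
Proof.
rewrite /central_square turnK opprK; apply/seteqP.
by split=> x /=; rewrite /set1 /=; tauto.
Qed.

(** The centre is the origin, so the opposite vertex is [- a], and the neighbours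
of [a] are its images under the two quarter turns. *)
Lemma square_on_circle a b c d : square_vertices a b c d ->
  dotp a a = 1 -> dotp b b = 1 -> dotp d d = 1 ->
  [set a; b; c; d] = central_square a.
Proof.
move/square_verticesP => [w1 [w2 [s [s1 pos -> -> ->]]]].
case: a => a1 a2; rewrite /dotp /= => ha hb hd.
have L0 : w1 ^+ 2 + w2 ^+ 2 != 0 by rewrite gt_eqF.
(* The foot of the perpendicular from the origin to a chord is its midpoint. *)
have aw : a1 * w1 + a2 * w2 = - (w1 ^+ 2 + w2 ^+ 2) / 2 by nra.
have av : a2 * (s * w1) - a1 * (s * w2) = - (w1 ^+ 2 + w2 ^+ 2) / 2.
  have : s ^+ 2 * (w1 ^+ 2 + w2 ^+ 2) = w1 ^+ 2 + w2 ^+ 2 by rewrite s1 mul1r.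
  by nra.
have a1E : a1 = - (w1 - s * w2) / 2.
  apply: (mulIf L0).
  transitivity (w1 * (a1 * w1 + a2 * w2) + s ^+ 2 * w2 * (a1 * w2 - a2 * w1)).
    by rewrite s1; ring.
  have -> : s ^+ 2 * w2 * (a1 * w2 - a2 * w1) =
    - (s * w2) * (a2 * (s * w1) - a1 * (s * w2)) by ring.
  by rewrite aw av; field.
have a2E : a2 = - (w2 + s * w1) / 2.
  apply: (mulIf L0).
  transitivity (w2 * (a1 * w1 + a2 * w2) + s ^+ 2 * w1 * (a2 * w1 - a1 * w2)).
    by rewrite s1; ring.
  have -> : s ^+ 2 * w1 * (a2 * w1 - a1 * w2) =
    s * w1 * (a2 * (s * w1) - a1 * (s * w2)) by ring.
  by rewrite aw av; field.
have cE : (a1 + w1 - s * w2, a2 + w2 + s * w1) = - (a1, a2).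
  by congr pair => /=; rewrite ?a1E ?a2E; field.
have dE : (a1 - s * w2, a2 + s * w1) = - (a1 + w1, a2 + w2).
  by congr pair => /=; rewrite ?a1E ?a2E; field.
rewrite cE dE.
move/eqP: s1; rewrite sqrf_eq1 => /orP[] /eqP s1.
- have -> : (a1 + w1, a2 + w2) = turn (a1, a2).
    by rewrite /turn /= a1E a2E s1; congr pair; field.
  by rewrite /central_square.
- have -> : (a1 + w1, a2 + w2) = - turn (a1, a2).
    by rewrite /turn /= a1E a2E s1; congr pair => /=; field.
  rewrite opprK /central_square; apply/seteqP.
  by split=> x /=; rewrite /set1 /=; tauto.
Qed.

(** The half-open quadrant is a fundamental domain of the quarter turn on the
punctured plane. *)
Lemma central_square_quadrant p : dotp p p = 1 ->
  exists u, [/\ central_square u = central_square p, dotp u u = 1,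
    0 < u.1 & 0 <= u.2].
Proof.
case: p => p1 p2; rewrite /dotp /= => p11.
have [h1|h1] := ltP 0 p1.
  have [h2|h2] := leP 0 p2; first by exists (p1, p2).
  exists (turn (p1, p2)); split; rewrite ?central_square_turn //=.
  - by rewrite -p11 /dotp /=; ring.
  - by rewrite oppr_gt0.
  - exact: ltW.
have [h2|h2] := ltP 0 p2.
  exists (- turn (p1, p2)); split.
  - by rewrite central_squareN central_square_turn.
  - by rewrite -p11 /dotp /=; ring.
  - by rewrite /= opprK.
  - by rewrite /= oppr_ge0.
have [e|n] := eqVneq p1 0.
  exists (turn (p1, p2)); split; rewrite ?central_square_turn //=.
  - by rewrite -p11 /dotp /=; ring.
  - by nra.
  - by rewrite e.
exists (- (p1, p2)); split; rewrite ?central_squareN //=.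
- by rewrite -p11 /dotp /=; ring.
- by rewrite oppr_gt0 lt_neqAle n.
- by rewrite oppr_ge0.
Qed.

Lemma central_square_inj u v : 0 < u.1 -> 0 <= u.2 -> 0 < v.1 -> 0 <= v.2 ->
  central_square u = central_square v -> u = v.
Proof.
move=> u1 u2 v1 v2 e.
have : central_square v u by rewrite -e /central_square; do 3 left.
case=> [[[//|]|]|]; rewrite /set1 /= => h; move: u1 u2; rewrite {e}h /= => *;
  by exfalso; lra.
Qed.

Lemma central_square_square u : dotp u u = 1 -> square (central_square u).
Proof.
case: u => u1 u2; rewrite /dotp /= => h.
exists (u1, u2), (turn (u1, u2)), (- (u1, u2)), (- turn (u1, u2)).
split=> //; rewrite /turn /dotp /=; first by congr pair => /=; ring.
- by ring.
- by ring.
- by nra.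
Qed.

Variable N : R * R -> R.
Hypothesis gN : gauge N.

(** If [a] is off the circle, each distribution of the other vertices on and off
the circle is excluded by one of the four previous configurations: three known
vertices on the circle, a side off, a diagonal off, or a corner off. *)
Lemma inscribed_vertex_on_circle a b c d : square_vertices a b c d ->
  gauge_curve N a -> gauge_curve N b -> gauge_curve N c -> gauge_curve N d ->
  dotp a a = 1.
Proof.
move=> sa ga gb gc gd.
have sb := square_vertices_rot sa; have sc := square_vertices_rot sb.
have sd := square_vertices_rot sc.
have [//|offa] := pselect (dotp a a = 1); exfalso.
have [a1 a2 _] := gauge_curve_off gN ga offa.
have corner x y z t : square_vertices x y z t -> gauge_curve N x ->
    gauge_curve N y -> gauge_curve N t -> dotp x x <> 1 -> dotp y y <> 1 ->
    dotp t t <> 1 -> False.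
  move=> sq gx gy gt offx offy offt.
  have [x1 x2 _] := gauge_curve_off gN gx offx.
  have [y1 y2 _] := gauge_curve_off gN gy offy.
  have [t1 t2 _] := gauge_curve_off gN gt offt.
  by apply: (corner_not_in_quadrant gN sq) => //; exact: ltW.
have [onb|offb] := pselect (dotp b b = 1);
  have [onc|offc] := pselect (dotp c c = 1);
  have [ond|offd] := pselect (dotp d d = 1).
- by apply: offa; exact: (square_fourth_on_circle sc).
- exact: (side_not_off gN sd).
- exact: (diagonal_not_off gN sa).
- exact: (corner _ _ _ _ sd).
- exact: (side_not_off gN sa).
- exact: (corner _ _ _ _ sa).
- exact: (corner _ _ _ _ sb).
- exact: (corner _ _ _ _ sa).
Qed.

(** Conversely the square of a point of contact is inscribed, because its three
other vertices avoid the open quadrant, and there [N] is the norm. *)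
Lemma inscribed_squaresE : inscribed_squares (gauge_curve N) =
  central_square @` [set u | [/\ dotp u u = 1, N u = 1, 0 < u.1 & 0 <= u.2]].
Proof.
apply/seteqP; split=> [Q [[a [b [c [d [QE e o l p]]]]] sub]|Q [u [u1 Nu up uq] <-]].
- have sa : square_vertices a b c d by split.
  have ga : gauge_curve N a by apply: sub; rewrite QE; do 3 left.
  have gb : gauge_curve N b by apply: sub; rewrite QE; do 2 left; right.
  have gc : gauge_curve N c by apply: sub; rewrite QE; left; right.
  have gd : gauge_curve N d by apply: sub; rewrite QE; right.
  have sb := square_vertices_rot sa; have sc := square_vertices_rot sb.
  have sd := square_vertices_rot sc.
  have ona := inscribed_vertex_on_circle sa ga gb gc gd.
  have onb := inscribed_vertex_on_circle sb gb gc gd ga.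
  have ond := inscribed_vertex_on_circle sd gd ga gb gc.
  have QEa := square_on_circle sa ona onb ond.
  have [u [uE u1 up uq]] := central_square_quadrant ona.
  exists u; last by rewrite uE -QEa.
  split=> //; apply: sub; rewrite QE QEa -uE; by do 3 left.
- split; first exact: central_square_square.
  have on_circle p : dotp p p = 1 -> ~ (0 < p.1 /\ 0 < p.2) -> gauge_curve N p.
    case: gN => _ _ _ h /enorm_eq1 p1 /h; rewrite p1.
    by [].
  have tE : dotp (turn u) (turn u) = 1 by rewrite -u1 /dotp /=; ring.
  have NE q : dotp (- q) (- q) = dotp q q by rewrite /dotp /=; ring.
  move=> x; rewrite /central_square /set1 /= => -[[[->//|->]|->]|->].
  + by apply: on_circle => //= -[]; rewrite oppr_gt0 ltNge uq.
  + by apply: on_circle; rewrite ?NE //= => -[]; rewrite oppr_gt0 ltNge ltW.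
  + by apply: on_circle; rewrite ?NE //= => -[_]; rewrite oppr_gt0 ltNge ltW.
Qed.

End SquaresOnCircle.

(** * The enclosed region is the open unit ball of the gauge *)

Section GaugeRegion.
Variables (R : realType) (N : R * R -> R).
Hypothesis gN : gauge N.
Let gamma := gauge_curve N.
Implicit Types p q : R * R.

Lemma norm_le_enorm p : `|p| <= enorm p.
Proof.
have h (x y : R) : `|x| <= Num.sqrt (x * x + y * y).
  by rewrite -sqrtr_sqr expr2 ler_wsqrtr // lerDl -expr2 sqr_ge0.
by rewrite prod_normE ge_max h /enorm /dotp addrC h.
Qed.

Lemma norm_le_gauge p : `|p| <= N p.
Proof. by case: gN => _ _ h _; exact: le_trans (norm_le_enorm p) (h p). Qed.

Lemma gauge_le_norm p : N p <= 2 * `|p|.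
Proof.
case: gN => _ subN _ flat.
have {1}-> : p = (p.1, 0) + (0, p.2).
  by case: p => x y; congr pair; rewrite /= ?addr0 ?add0r.
apply: (le_trans (subN _ _)).
rewrite !flat /= ?ltxx; try by case.
rewrite /enorm /dotp /= mulr0 addr0 add0r -!expr2 !sqrtr_sqr mulr2n mulrDl mul1r.
by rewrite prod_normE lerD // le_max lexx ?orbT.
Qed.

Lemma gauge_continuous : continuous N.
Proof.
case: gN => _ subN _ _ p; apply/cvgrPdist_lt => e e0.
near=> q.
have pq : 2 * `|p - q| < e.
  rewrite mulrC -ltr_pdivlMr //; near: q.
  by apply: cvgr_dist_lt; [exact: cvg_id | rewrite divr_gt0].
rewrite ltr_norml; apply/andP; split.
- have := subN (q - p) p; rewrite subrK => h.
  have := gauge_le_norm (q - p); rewrite distrC => h'; lra.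
- have := subN (p - q) q; rewrite subrK => h.
  by have := gauge_le_norm (p - q); lra.
Unshelve. all: by end_near. Qed.

(** A point with [N p > 1] is joined to infinity by a ray on which [N] exceeds 1.
From a point with [N p < 1], a connected set avoiding the curve stays, by the
intermediate value theorem, in the bounded set where [N < 1]. *)
Lemma enclosed_region_gauge : enclosed_region gamma = [set p | N p < 1].
Proof.
apply/seteqP; split=> p /=.
- case=> ngp bnd; rewrite ltNge; apply/negP => p1.
  case: (gN) => homN _ _ _.
  have p_gt1 : 1 < N p by rewrite lt_neqAle p1 andbT eq_sym; apply/eqP.
  have p_gt0 : 0 < `|p|.
    rewrite normr_gt0; apply/eqP => e; move: p_gt1; rewrite e.
    by have := gauge_le_norm 0; rewrite normr0 mulr0; lra.
  pose ray : set (R * R) := (fun t => t *: p) @` `[1, +oo[%classic.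
  have ray_conn : connected ray.
    apply: connected_continuous_connected.
      exact/connected_intervalP/interval_is_interval.
    by apply: continuous_subspaceT => t; apply: continuousZr_tmp.
  have ray_sub : ray `<=` connected_component (~` gamma) p.
    apply: connected_component_max => //.
      by exists 1; rewrite ?scale1r //= in_itv /= lexx.
    move=> _ [t] t1 <-; move: t1; rewrite /= in_itv /= andbT => t1.
    rewrite /gamma /gauge_curve /= homN; last by lra.
    by move=> e; nra.
  have [M /= [Mreal bM]] := bnd.
  pose K := Num.max (M + 1) 1.
  have KM : M < K by rewrite /K lt_max ltrDl ltr01.
  have K1 : 1 <= K by rewrite /K le_max lexx orbT.
  pose t := 1 + K / `|p|.
  have t1 : 1 <= t by rewrite lerDl divr_ge0 //; lra.
  have /= := bM _ KM (t *: p) (ray_sub _ _).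
  have -> : `|t *: p| = `|p| + K.
    by rewrite normrZ ger0_norm ?(le_trans _ t1) // /t mulrDl mul1r divfK // gt_eqF.
  move=> h; have : `|p| + K <= K by apply: h; exists t; rewrite //= in_itv /= t1.
  by rewrite gerDr leNgt p_gt0.
- move=> p1; have ngp : (~` gamma) p by rewrite /gamma /gauge_curve /= => e; lra.
  split=> //; exists 1; split=> // M M1 q /= Cq.
  have q1 : N q < 1; last first.
    by apply: le_trans (norm_le_gauge q) _; exact/ltW/(lt_trans q1).
  rewrite ltNge; apply/negP => q1.
  have : connected (N @` connected_component (~` gamma) p).
    apply: connected_continuous_connected; first exact: component_connected.
    by apply: continuous_subspaceT; exact: gauge_continuous.
  move/connected_intervalP => itv.
  have [r Cr Nr] : (N @` connected_component (~` gamma) p) 1.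
    apply: (itv (N p) (N q)); last by rewrite q1 ltW.
    - by exists p => //; exact: connected_component_refl.
    - by exists q.
  exact: (connected_component_sub Cr).
Qed.

Lemma gauge_curve_convex : convex_curve gamma.
Proof.
rewrite /convex_curve enclosed_region_gauge => p q l.
rewrite !inE /= => p1 q1.
have -> : (conv l p q : R * R) = l%:num *: (p : R * R) + (1 - l%:num) *: (q : R * R).
  by [].
case: gN => homN subN _ _.
have l0 : 0 <= l%:num by [].
have l1 : 0 <= 1 - l%:num :> R by rewrite subr_ge0.
apply: (le_lt_trans (subN _ _)); rewrite !homN //.
have [e|ln0] := eqVneq (l%:num : R) 0; first by rewrite e mul0r add0r subr0 mul1r.
have lp : 0 < l%:num :> R by rewrite lt_neqAle eq_sym ln0.
by move: l0 l1 lp; move: (l%:num : R) (N p) (N q) p1 q1 => *; nra.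
Qed.

Definition radial p : R * R := (N p)^-1 *: p.

Lemma unit_circleE p : unit_circle R p <-> enorm p = 1.
Proof. by rewrite enorm_eq1 /unit_circle /= /dotp !expr2. Qed.

Lemma gauge_circle_gt0 p : unit_circle R p -> 0 < N p.
Proof.
move/unit_circleE => p1; case: gN => _ _ /(_ p) + _; rewrite p1.
exact: lt_le_trans.
Qed.

Lemma radial_inj : set_inj (unit_circle R) radial.
Proof.
move=> p q; rewrite !inE => cp cq e.
have Np := gauge_circle_gt0 cp; have Nq := gauge_circle_gt0 cq.
have : enorm (radial p) = enorm (radial q) by rewrite e.
rewrite !enormZ ?invr_ge0 ?ltW //.
move/unit_circleE: cp => ->; move/unit_circleE: cq => ->; rewrite !mulr1.
move=> eN; move: e; rewrite /radial eN => /scalerI; apply.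
by rewrite invr_eq0 gt_eqF.
Qed.

Lemma radial_image : gamma = radial @` unit_circle R.
Proof.
case: (gN) => homN _ ge flat.
have Nn p : 0 <= N p by apply: le_trans (norm_le_gauge p).
apply/seteqP; split=> [p Np|_ [p cp <-]].
- have p0 : 0 < enorm p.
    rewrite lt_neqAle enorm_ge0 andbT eq_sym; apply/eqP => e.
    have : N p <= 0.
      apply: le_trans (gauge_le_norm p) _.
      by have := norm_le_enorm p; lra.
    by rewrite (Np : N p = 1) ler10.
  have i0 : 0 <= (enorm p)^-1 by rewrite invr_ge0 ltW.
  exists ((enorm p)^-1 *: p).
    by apply/unit_circleE; rewrite enormZ // mulVf // gt_eqF.
  rewrite /radial homN // (Np : N p = 1) mulr1 invrK scalerA divff ?scale1r //.
  by rewrite gt_eqF.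
- have Np := gauge_circle_gt0 cp.
  by rewrite /gamma /gauge_curve /= homN ?invr_ge0 ?ltW // mulVf // gt_eqF.
Qed.

Lemma gauge_curve_simple_closed : simple_closed_curve gamma.
Proof.
exists radial; split; [|exact: radial_inj|exact: radial_image].
apply: continuous_in_subspaceT => p; rewrite inE => /gauge_circle_gt0 Np.
apply: (@cvgZ R (R * R)%type _ (nbhs p) _ (fun q => (N q)^-1) id).
  apply: (@continuousV _ _ N p); first by rewrite gt_eqF.
  exact: gauge_continuous.
exact: cvg_id.
Qed.

End GaugeRegion.

(** * Subadditivity in polar coordinates *)

Section Polar.
Variable R : realType.
Implicit Types p q : R * R.

Lemma circle_angle p : dotp p p = 1 ->
  exists2 t, - pi <= t <= pi & p = (cos t, sin t).
Proof.
case: p => x y; rewrite /dotp /= => xy.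
have x1 : -1 <= x <= 1 by apply/andP; split; nra.
have pi0 := @pi_ge0 R.
have cosE : cos (acos x) = x by rewrite acosK // in_itv.
have sinE : sin (acos x) = `|y|.
  rewrite sin_acos // -sqrtr_sqr; congr Num.sqrt.
  by rewrite -xy; ring.
have a0 := acos_ge0 x1; have api := acos_lepi x1.
have [y0|y0] := leP 0 y.
- exists (acos x); first by apply/andP; split => //; lra.
  by rewrite cosE sinE ger0_norm.
- exists (- acos x); first by apply/andP; split; lra.
  by rewrite cosN sinN cosE sinE ltr0_norm // opprK.
Qed.

Lemma polar p : exists t, - pi <= t <= pi /\ p = enorm p *: (cos t, sin t).
Proof.
have [e|n0] := eqVneq (enorm p) 0.
  exists 0; split; first by rewrite oppr_le0 pi_ge0.
  have := enorm_sqr p; rewrite e expr0n /= scale0r /dotp; case: p {e} => x y /= h.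
  by congr pair; nra.
have i0 : 0 <= (enorm p)^-1 by rewrite invr_ge0 enorm_ge0.
have [|t tpi pE] := @circle_angle ((enorm p)^-1 *: p).
  by apply/enorm_eq1; rewrite enormZ // mulVf.
by exists t; split=> //; rewrite -pE scalerA mulfV // scale1r.
Qed.

(** Geometrically, the curve [r = 1 / k] of nonnegative curvature stays on one side
of its tangent line at angle [a]. The function [W] below interpolates between
the two members, as [x] runs from [a] to [b], and its derivative
[(k + k2) sin (b - x)] has the sign of [b - x] because [b - x] is at most pi in
absolute value. *)
Lemma tangent_line_le (k k1 k2 : R -> R) (a b : R) :
  (forall x : R, is_derive x 1 k (k1 x)) ->
  (forall x : R, is_derive x 1 k1 (k2 x)) ->
  - pi <= b - a <= pi ->
  (forall x, (a <= x <= b) || (b <= x <= a) -> 0 <= k x + k2 x) ->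
  k a * cos (b - a) + k1 a * sin (b - a) <= k b.
Proof.
move=> dk dk1 ab curv.
pose W x := k x * cos (b - x) + k1 x * sin (b - x).
have dW (x : R) : is_derive x 1 W ((k x + k2 x) * sin (b - x)).
  have db : is_derive x 1 (fun y => b - y) (-1).
    by have := is_deriveB (is_derive_cst b x 1) (is_derive_id x (1 : R)); rewrite sub0r.
  have dc := @is_derive1_comp R cos (fun y => b - y) x _ _ (is_derive_cos (b - x)) db.
  have ds := @is_derive1_comp R sin (fun y => b - y) x _ _ (is_derive_sin (b - x)) db.
  have := is_deriveD (is_deriveM (dk x) dc) (is_deriveM (dk1 x) ds).
  by move/is_derive_eq; apply; rewrite /= /GRing.scale /=; ring.
have W1 x : W^`() x = (k x + k2 x) * sin (b - x) by rewrite derive1E derive_val.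
have Wd x : derivable W x 1 by [].
have Wc : continuous W by move=> x; apply/differentiable_continuous/derivable1_diffP.
have -> : k b = W b by rewrite /W subrr cos0 sin0; ring.
rewrite -[leLHS]/(W a); have [le_ab|le_ba] := leP a b.
- apply: (@ger0_derive1_le_cc _ W a b _ _ (continuous_subspaceT Wc));
    rewrite ?bound_itvE //.
  move=> x; rewrite in_itv /= => /andP[ax xb]; rewrite W1 mulr_ge0 //.
    by apply: curv; rewrite (ltW ax) (ltW xb).
  apply: sin_ge0_pi; rewrite subr_ge0 (ltW xb) /=.
  by case/andP: ab => _; apply: le_trans; rewrite lerB // ltW.
- apply: (@ler0_derive1_le_cc _ W b a _ _ (continuous_subspaceT Wc));
    rewrite ?bound_itvE ?ltW //.
  move=> x; rewrite in_itv /= => /andP[bx xa]; rewrite W1 mulr_ge0_le0 //.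
    by apply: curv; rewrite (ltW bx) (ltW xa) orbT.
  rewrite -opprB sinN oppr_le0; apply: sin_ge0_pi.
  rewrite subr_ge0 (ltW bx) /=.
  by case/andP: ab => + _; rewrite lerNl opprB; apply: le_trans; rewrite lerB // ltW.
Qed.

(** [N] is the upper envelope of its tangent linear forms: the form [l] tangent in
the direction of [p + q] is below [N] everywhere, and equal to [N] at [p + q].
The direction of [p + q] is taken in [-pi, pi] and the other ones within pi of
it, hence the interval on which the sign of [k + k2] matters. *)
Lemma gauge_subadditive (N : R * R -> R) (k k1 k2 : R -> R) :
  (forall t p, 0 <= t -> N (t *: p) = t * N p) ->
  (forall t, N (cos t, sin t) = k t) ->
  (forall x : R, is_derive x 1 k (k1 x)) ->
  (forall x : R, is_derive x 1 k1 (k2 x)) ->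
  (forall x, - (2 * pi) <= x <= 2 * pi -> 0 <= k x + k2 x) ->
  forall p q, N (p + q) <= N p + N q.
Proof.
move=> homN Nk dk dk1 curv p q.
have [a [api sumE]] := polar (p + q).
pose l (u : R * R) := k a * (u.1 * cos a + u.2 * sin a) +
  k1 a * (u.2 * cos a - u.1 * sin a).
have lN u : l u <= N u.
  have [t [tpi]] := polar (u.1 * cos a + u.2 * sin a, u.2 * cos a - u.1 * sin a).
  move: (enorm _) (enorm_ge0 (u.1 * cos a + u.2 * sin a, u.2 * cos a - u.1 * sin a)).
  move=> r r0 [e1 e2].
  have ca := cos2Dsin2 a.
  have lE : l u = r * (k a * cos t + k1 a * sin t).
    by rewrite /l e1 e2 /= /GRing.scale /=; ring.
  rewrite lE; have -> : u = r *: (cos (a + t), sin (a + t)).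
    rewrite scale_pairE /= cosD sinD; case: u e1 e2 {lE} => x y /= e1 e2.
    congr pair => /=.
    + transitivity ((cos a ^+ 2 + sin a ^+ 2) * x); first by rewrite ca mul1r.
      transitivity (cos a * (x * cos a + y * sin a) - sin a * (y * cos a - x * sin a));
        first by ring.
      by rewrite e1 e2 /= /GRing.scale /=; ring.
    + transitivity ((cos a ^+ 2 + sin a ^+ 2) * y); first by rewrite ca mul1r.
      transitivity (sin a * (x * cos a + y * sin a) + cos a * (y * cos a - x * sin a));
        first by ring.
      by rewrite e1 e2 /= /GRing.scale /=; ring.
  rewrite homN // Nk.
  apply: ler_wpM2l => //.
  have -> : t = (a + t) - a by ring.
  rewrite [in leRHS]addrC subrK; apply: tangent_line_le dk dk1 _ _; first by lra.
  by move=> x xs; apply: curv; move: xs => /orP[] /andP[]; lra.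
have la r : l (r *: (cos a, sin a)) = r * k a.
  rewrite scale_pairE /l /=.
  transitivity (k a * r * (cos a ^+ 2 + sin a ^+ 2)); first by ring.
  by rewrite cos2Dsin2; ring.
have -> : N (p + q) = l (p + q).
  by rewrite sumE homN ?enorm_ge0 // Nk la.
apply: le_trans (lerD (lN p) (lN q)).
by rewrite /l /=; lra.
Qed.

End Polar.

(** * Smooth functions on the line *)

Section Smooth.
Variable R : realType.
Implicit Types (f g : R -> R) (n : nat).

Lemma is_derive_recip f (x df : R) : is_derive x 1 f df -> f x != 0 ->
  is_derive x 1 (fun y => (f y)^-1) (- 1 * ((f x)^-1 * (f x)^-1) * df).
Proof.
move=> dfx fx0; have [fd fE] := dfx.
apply: DeriveDef; first exact: derivableV.
by rewrite deriveV // fE /GRing.scale /= expr2 invfM mulN1r.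
Qed.

(** The recursion takes the derivative first: this makes the closure properties
provable by induction on [n] with the product and chain rules, the functions
being universally quantified. *)
Fixpoint times_derivable n f : Prop :=
  if n is m.+1 then (forall x : R, derivable f x 1) /\ times_derivable m (derive1 f)
  else True.

Definition smooth f : Prop := forall n, times_derivable n f.

Lemma times_derivableS n f g : (forall x : R, is_derive x 1 f (g x)) ->
  times_derivable n g -> times_derivable n.+1 f.
Proof.
move=> df gn; split=> [x|]; first by have [] := df x.
by rewrite (_ : (derive1 f) = g) //; apply/funext => x; rewrite derive1E derive_val.
Qed.

Lemma times_derivableW n f : times_derivable n.+1 f -> times_derivable n f.
Proof. by elim: n f => //= n IHn f [df dn]; split=> //; apply: IHn. Qed.

Lemma times_derivable_is_derive n f (x : R) : times_derivable n.+1 f ->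
  is_derive x 1 f (derive1 f x).
Proof. by case=> df _; rewrite derive1E; apply: derivableP. Qed.

Lemma times_derivable_cst n (c : R) : times_derivable n (fun=> c).
Proof.
elim: n c => // n IHn c; apply: (@times_derivableS n _ (fun=> 0)).
exact: IHn.
Qed.

Lemma times_derivableD n f g : times_derivable n f -> times_derivable n g ->
  times_derivable n (fun x => f x + g x).
Proof.
elim: n f g => // n IHn f g fn gn.
apply: (@times_derivableS n _ (fun x => derive1 f x + derive1 g x)).
  move=> x; exact: is_deriveD (times_derivable_is_derive x fn)
    (times_derivable_is_derive x gn).
by apply: IHn; [case: fn | case: gn].
Qed.

Lemma times_derivableM n f g : times_derivable n f -> times_derivable n g ->
  times_derivable n (fun x => f x * g x).
Proof.
elim: n f g => // n IHn f g fn gn.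
apply: (@times_derivableS n _ (fun x => f x * derive1 g x + g x * derive1 f x)).
  move=> x; exact: is_deriveM (times_derivable_is_derive x fn)
    (times_derivable_is_derive x gn).
by apply: times_derivableD; apply: IHn; do ?[exact: times_derivableW];
  [case: gn | case: fn].
Qed.

Lemma times_derivable_comp n f g : times_derivable n f -> times_derivable n g ->
  times_derivable n (fun x => g (f x)).
Proof.
elim: n f g => // n IHn f g fn gn.
apply: (@times_derivableS n (g \o f) (fun x => derive1 g (f x) * derive1 f x)).
  move=> x; exact: is_derive1_comp (times_derivable_is_derive (f x) gn)
    (times_derivable_is_derive x fn).
apply: times_derivableM; last by case: fn.
by apply: IHn; [exact: times_derivableW | case: gn].
Qed.

Lemma times_derivableV n f : (forall x, f x != 0) -> times_derivable n f ->
  times_derivable n (fun x => (f x)^-1).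
Proof.
move=> f0; elim: n => // n IHn fn.
apply: (@times_derivableS n _ (fun x => - 1 * ((f x)^-1 * (f x)^-1) * derive1 f x)).
  by move=> x; exact: is_derive_recip (times_derivable_is_derive x fn) (f0 x).
apply: times_derivableM; last by case: fn.
apply: times_derivableM; first exact: times_derivable_cst.
by apply: times_derivableM; apply: IHn; exact: times_derivableW.
Qed.

Lemma smooth_cst (c : R) : smooth (fun=> c).
Proof. by move=> n; exact: times_derivable_cst. Qed.

Lemma smoothD f g : smooth f -> smooth g -> smooth (fun x => f x + g x).
Proof. by move=> fs gs n; exact: times_derivableD. Qed.

Lemma smoothM f g : smooth f -> smooth g -> smooth (fun x => f x * g x).
Proof. by move=> fs gs n; exact: times_derivableM. Qed.

Lemma smooth_comp f g : smooth f -> smooth g -> smooth (fun x => g (f x)).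
Proof. by move=> fs gs n; exact: times_derivable_comp. Qed.

Lemma smoothV f : (forall x, f x != 0) -> smooth f -> smooth (fun x => (f x)^-1).
Proof. by move=> f0 fs n; exact: times_derivableV. Qed.

Lemma smooth_derive1 f : smooth f -> smooth (derive1 f).
Proof. by move=> fs n; have [] := fs n.+1. Qed.

Lemma smooth_is_derive f (x : R) : smooth f -> is_derive x 1 f (derive1 f x).
Proof. by move=> fs; apply: (@times_derivable_is_derive 0). Qed.

Lemma smooth_prod I (r : seq I) (F : I -> R -> R) : (forall i, smooth (F i)) ->
  smooth (fun x => \prod_(i <- r) F i x).
Proof.
move=> Fs; elim: r => [|i r IHr].
  rewrite (_ : (fun x => _) = fun=> 1); first exact: smooth_cst.
  by apply/funext => x; rewrite big_nil.
rewrite (_ : (fun x => _) = fun x => F i x * \prod_(j <- r) F j x).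
  exact: smoothM.
by apply/funext => x; rewrite big_cons.
Qed.

Lemma smooth_cos_sin : smooth cos /\ smooth sin.
Proof.
suff h n : times_derivable n (@cos R) /\ times_derivable n (@sin R).
  by split=> n; have [] := h n.
elim: n => // n [cn sn]; split.
- apply: (@times_derivableS n _ (fun x => -1 * sin x)).
    by move=> x; rewrite mulN1r; exact: is_derive_cos.
  by apply: times_derivableM => //; exact: times_derivable_cst.
- by apply: (@times_derivableS n _ cos).
Qed.

Lemma smooth_pair_diff f g (x : R) : smooth f -> smooth g ->
  differentiable (fun y => (f y, g y)) x /\
  derive1 (fun y => (f y, g y)) x = (derive1 f x, derive1 g x).
Proof.
move=> fs gs.
have df : differentiable f x by apply/derivable1_diffP; have [] := fs 1%N.
have dg : differentiable g x by apply/derivable1_diffP; have [] := gs 1%N.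
split; first exact: differentiable_pair.
rewrite derive1E'; last exact: differentiable_pair.
by rewrite diff_pair //= !derive1E'.
Qed.

Lemma smooth_pair f g : smooth f -> smooth g -> forall n (t : R),
  derivable (derive1n n (fun x => (f x, g x))) t 1.
Proof.
move=> fs gs n; elim: n f g fs gs => [|n IHn] f g fs gs t.
  by apply/derivable1_diffP; have [] := smooth_pair_diff t fs gs.
rewrite derive1Sn (_ : derive1 _ = fun x => (derive1 f x, derive1 g x)).
  by apply: IHn; exact: smooth_derive1.
by apply/funext => x; have [] := smooth_pair_diff x fs gs.
Qed.

(** The negative powers of x are there because the family is closed under
derivation, up to linear combinations: [is_derive_flat]. *)
Definition flat n (x : R) : R :=
  if 0 < x then x ^- n * expR (- x^-1) else 0.

Lemma flat_ge0 n x : 0 <= flat n x.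
Proof.
rewrite /flat; case: ifP => // x0.
by rewrite mulr_ge0 ?expR_ge0 // invr_ge0 exprn_ge0 // ltW.
Qed.

(** The exponential of 1/x dominates its Taylor monomial of degree n+2; the degree
is chosen to leave a square, which makes the derivative at 0 vanish. *)
Lemma flat_quadratic n x : `|flat n x| <= (n.+2)`!%:R * x ^+ 2.
Proof.
rewrite ger0_norm ?flat_ge0 // /flat; case: ifP => [x0|_]; last first.
  by rewrite mulr_ge0 // sqr_ge0.
rewrite expRN.
have y0 : 0 < x^-1 by rewrite invr_gt0.
have := @expR_ge1Dxn _ x^-1 n.+1 (ltW y0) => h.
have {}h : x^-1 ^+ n.+2 / (n.+2)`!%:R <= expR x^-1.
  by apply: le_trans h; rewrite lerDr.
rewrite ler_pdivrMr ?expR_gt0 //.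
have f0 : 0 < (n.+2)`!%:R :> R by rewrite ltr0n fact_gt0.
apply: le_trans (ler_wpM2l _ h); last by rewrite mulr_ge0 ?sqr_ge0 // ltW.
rewrite le_eqVlt; apply/orP; left; apply/eqP.
have xn0 : x != 0 by rewrite gt_eqF.
rewrite exprVn (_ : n.+2 = (n + 2)%N); last by rewrite addn2.
rewrite exprD; field; rewrite xn0 expf_neq0 // gt_eqF //.
Qed.

Lemma quadratic_is_derive0 f (C : R) : (forall x, `|f x| <= C * x ^+ 2) ->
  is_derive (0 : R) 1 f 0.
Proof.
move=> fC.
have f0 : f 0 = 0.
  by apply/normr0_eq0/le_anti; rewrite normr_ge0 (le_trans (fC _)) // expr0n mulr0.
have cv : h^-1 *: (f (h *: (1 : R) + 0) - f 0) @[h --> (0 : R)^'] --> (0 : R).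
  apply/cvgr0Pnorm_le => e e0; near=> h.
  have hn0 : h != 0 by near: h; exact: nbhs_dnbhs_neq.
  rewrite f0 subr0 addr0 /GRing.scale /= mulr1 normrM normfV.
  rewrite ler_pdivrMl ?normr_gt0 //.
  have C0 : 0 < `|C| + 1 by rewrite ltr_wpDl.
  have hC : `|h| <= e / (`|C| + 1).
    by near: h; apply: dnbhs0_le; rewrite divr_gt0.
  apply: (le_trans (fC h)); rewrite -(real_normK (num_real h)) expr2.
  rewrite ler_pdivlMr // in hC.
  have CC := ler_norm C; have h0 := normr_ge0 h.
  by move: (`|h|) (`|C|) C0 hC CC h0; clear => y D D0 hC CC y0; nra.
apply: DeriveDef; first by apply/cvg_ex; exists 0.
exact: cvg_lim cv.
Unshelve. all: by end_near.
Qed.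

Lemma is_derive_flat n (x : R) :
  is_derive x 1 (flat n) (- n%:R * flat n.+1 x + flat n.+2 x).
Proof.
have [x0|x0|->] := ltgtP x 0.
- have -> : - n%:R * flat n.+1 x + flat n.+2 x = 0.
    by rewrite /flat ltNge (ltW x0) /= mulr0 addr0.
  apply: near_eq_is_derive (is_derive_cst 0 x 1).
  near=> y; rewrite /flat ifF //; apply/negbTE; rewrite -leNgt ltW //.
  by near: y; exact: lt_nbhsl.
- suff: is_derive x 1 (fun y : R => y ^- n * expR (- y^-1))
      (- n%:R * flat n.+1 x + flat n.+2 x).
    apply: near_eq_is_derive; near=> y; rewrite /flat ifT //.
    by near: y; exact: lt_nbhsr.
  have xn0 : x != 0 by rewrite gt_eqF.
  have dinv := is_derive_recip (is_derive_id x (1 : R)) xn0.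
  have dpow : is_derive x^-1 1 (fun u : R => u ^+ n) (n%:R * x^-1 ^+ n.-1).
    apply: DeriveDef; first exact: exprn_derivable.
    by rewrite -derive1E exp_derive1.
  have dexp : is_derive x^-1 1 (fun u => expR (- u)) (- expR (- x^-1)).
    have := @is_derive1_comp R expR -%R x^-1 _ _ (is_derive_expR _) (is_deriveNid x^-1 1).
    by move/is_derive_eq; apply; rewrite mulrN1.
  have := @is_derive1_comp R (fun u : R => u ^+ n * expR (- u)) (fun y => y^-1) x _ _
    (is_deriveM dpow dexp) dinv.
  rewrite (_ : _ \o _ = fun y => y ^- n * expR (- y^-1)); last first.
    by apply/funext => y /=; rewrite exprVn.
  move/is_derive_eq; apply; rewrite /flat x0 /GRing.scale /=.
  case: n {dpow dexp} => [|n] /=.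
    by rewrite -!exprVn; ring.
  by rewrite -!exprVn !exprS; ring.
- rewrite /flat ltxx mulr0 addr0; exact: quadratic_is_derive0 (flat_quadratic n).
Unshelve. all: by end_near.
Qed.

Lemma smooth_flat n : smooth (flat n).
Proof.
move=> m; elim: m n => // m IHm n.
apply: times_derivableS (is_derive_flat n) _.
apply: times_derivableD => //.
by apply: times_derivableM => //; exact: times_derivable_cst.
Qed.

End Smooth.

(** * The dented circle *)

Section SmoothGauge.
Variable R : realType.

(** In the angular coordinate the radial projection is [g(t) (cos t, sin t)] with
[g > 0], and the component of its velocity orthogonal to the radius is [g]. *)
Lemma gauge_curve_smooth (N : R * R -> R) : gauge N ->
  smooth (fun t => N (cos t, sin t)) -> smooth_curve (gauge_curve N).
Proof.
move=> gN ks.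
pose g t := (N (cos t, sin t))^-1.
have N0 t : 0 < N (cos t, sin t).
  by apply: gauge_circle_gt0 => //; rewrite /unit_circle /= cos2Dsin2.
have gs : smooth g by apply: smoothV => // t; rewrite gt_eqF.
have [cs ss] := smooth_cos_sin R.
have xs := smoothM gs cs; have ys := smoothM gs ss.
have angE : angular (radial N) = fun t => (g t * cos t, g t * sin t) by [].
exists (radial N); rewrite angE; split.
- exact: smooth_pair.
- move=> t; have [_ ->] := smooth_pair_diff t xs ys.
  apply/eqP => -[].
  have dg := smooth_is_derive t gs.
  have dc := is_derive_cos t; have ds := is_derive_sin t.
  have dx := is_deriveM dg dc; have dy := is_deriveM dg ds.
  rewrite !derive1E (@derive_val _ _ _ _ _ _ _ dx) (@derive_val _ _ _ _ _ _ _ dy).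
  rewrite /GRing.scale /= => ex ey.
  have : g t = 0.
    rewrite -[LHS]mulr1 -(cos2Dsin2 t).
    transitivity (cos t * (g t * cos t + sin t * derive1 g t) -
      sin t * (g t * - sin t + cos t * derive1 g t)); first by ring.
    by rewrite ex ey; ring.
  by move/eqP; rewrite invr_eq0 gt_eqF.
- exact: radial_inj.
- exact: radial_image.
Qed.

End SmoothGauge.

Section Dent.
Variables (R : realType) (n : nat).
Implicit Types (p u : R * R) (e : R).

(** On the unit circle, [u.1 + u.2 > 1] characterizes the open first quadrant, and
the product vanishes at the heights [i / n], to order two so as to keep the dent
nonnegative. *)
Definition dent u : R :=
  flat 0 (u.1 + u.2 - 1) * \prod_(i < n) (u.2 - i%:R / n%:R) ^+ 2.

Definition dented_norm e p : R :=
  enorm p * (1 + e * dent ((enorm p)^-1 *: p)).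

Lemma dent_ge0 u : 0 <= dent u.
Proof. by rewrite mulr_ge0 ?flat_ge0 // prodr_ge0 // => i _; exact: sqr_ge0. Qed.

Lemma flat_eq0 m (x : R) : (flat m x == 0) = (x <= 0).
Proof.
rewrite /flat; have [x0|x0] := ltP 0 x; last by rewrite eqxx.
by rewrite mulf_eq0 expR_eq0 orbF invr_eq0 expf_eq0 gt_eqF // andbF.
Qed.

Lemma dent_smooth : smooth (fun t => dent (cos t, sin t)).
Proof.
have [cs ss] := smooth_cos_sin R.
apply: smoothM.
  apply: smooth_comp (smooth_flat R 0); apply: smoothD; last exact: smooth_cst.
  exact: smoothD.
apply: smooth_prod => i.
have fs := smoothD ss (smooth_cst (- (i%:R / n%:R))).
exact: (smoothM fs fs).
Qed.

Lemma unit_quadrant_sum u : dotp u u = 1 -> 0 < u.1 -> 0 <= u.2 ->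
  u.1 + u.2 <= 1 -> u.2 = 0.
Proof. by case: u => x y; rewrite /dotp /= => *; nra. Qed.

Lemma dent_eq0 u : (0 < n)%N -> dotp u u = 1 -> 0 < u.1 -> 0 <= u.2 ->
  dent u = 0 <-> exists2 i : nat, (i < n)%N & u.2 = i%:R / n%:R.
Proof.
move=> n0 u1 up uq; split=> [/eqP|[i ni uE]]; last first.
  apply/eqP; rewrite mulf_eq0; apply/orP; right.
  by rewrite (bigD1 (Ordinal ni)) //= uE subrr expr0n mul0r.
rewrite mulf_eq0 flat_eq0 subr_le0 => /orP[h|/prodf_eq0 [i _]].
  by exists 0%N => //; rewrite mul0r; exact: unit_quadrant_sum h.
by rewrite sqrf_eq0 subr_eq0 => /eqP h; exists i.
Qed.

Lemma dented_norm_unit e u : dotp u u = 1 -> dented_norm e u = 1 + e * dent u.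
Proof. by move/enorm_eq1 => u1; rewrite /dented_norm u1 invr1 scale1r mul1r. Qed.

Lemma smooth_bounded_below (f : R -> R) (a b : R) : a <= b -> smooth f ->
  exists2 M, 0 < M & forall t, a <= t <= b -> - M <= f t.
Proof.
move=> ab fs.
have fc : continuous f.
  move=> x; apply/differentiable_continuous/derivable1_diffP.
  by have [] := fs 1%N.
have [c _ fmin] := EVT_min ab (continuous_subspaceT fc).
exists (`|f c| + 1); first by rewrite ltr_wpDl.
move=> t tab; apply: le_trans (fmin t tab); rewrite lerNl.
by have := ler_norm (- f c); rewrite normrN; lra.
Qed.

(** The factor [e] is chosen small enough for the curvature [1 + e (h + h'')] to
remain nonnegative. Off the open quadrant, a coordinate of the unit vector is
nonpositive and the other one at most 1, so that the flat factor vanishes. *)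
Lemma dented_norm_gauge : exists2 e : R, 0 < e & gauge (dented_norm e).
Proof.
pose h (t : R) := dent (cos t, sin t).
have hs : smooth h := dent_smooth.
have h1s := smooth_derive1 hs; have h2s := smooth_derive1 h1s.
have pi2 : - (2 * pi) <= 2 * pi :> R by have := @pi_ge0 R; lra.
have [M M0 hM] := smooth_bounded_below pi2 (smoothD hs h2s).
pose e := M^-1.
have e0 : 0 < e by rewrite invr_gt0.
exists e => //.
have dscale (f : R -> R) (t df : R) : is_derive t 1 f df ->
    is_derive t 1 (fun x => e * f x) (e * df).
  move=> dff; have := is_deriveM (is_derive_cst e t 1) dff.
  by move/is_derive_eq; apply; rewrite scaler0 addr0.
have homN t p : 0 <= t -> dented_norm e (t *: p) = t * dented_norm e p.
  rewrite le_eqVlt => /orP[/eqP <-|t0].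
    by rewrite /dented_norm enormZ // !mul0r.
  have tE : (t * enorm p)^-1 * t = (enorm p)^-1.
    by rewrite invfM mulrAC mulVf ?gt_eqF // mul1r.
  by rewrite /dented_norm enormZ ?ltW // scalerA tE -mulrA.
split=> //.
- have circ t : dotp (cos t, sin t) (cos t, sin t) = 1 :> R.
    by rewrite /dotp /= -!expr2 cos2Dsin2.
  apply: (@gauge_subadditive _ _ (fun t => 1 + e * h t)
    (fun t => e * derive1 h t) (fun t => e * derive1 (derive1 h) t)) => //.
  + by move=> t; exact: dented_norm_unit.
  + move=> t; have := is_deriveD (is_derive_cst (1 : R) t 1)
      (dscale _ _ _ (smooth_is_derive t hs)).
    by move/is_derive_eq; apply; rewrite add0r.
  + by move=> t; exact: dscale _ _ _ (smooth_is_derive t h1s).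
  + move=> t tI; rewrite -addrA -mulrDr -lerBlDl sub0r.
    by rewrite -(mulVf (lt0r_neq0 M0)) -mulrN ler_pM2l // hM.
- move=> p; rewrite /dented_norm ler_peMr ?enorm_ge0 // lerDl.
  by rewrite mulr_ge0 ?dent_ge0 // ltW.
- move=> p np; rewrite /dented_norm /dent.
  suff /eqP -> : flat 0 (((enorm p)^-1 *: p).1 + ((enorm p)^-1 *: p).2 - 1) == 0.
    by rewrite mul0r mulr0 addr0 mulr1.
  rewrite flat_eq0 subr_le0 /= /GRing.scale /=.
  have i0 : 0 <= (enorm p)^-1 by rewrite invr_ge0 enorm_ge0.
  have ple1 x : x <= `|p| -> (enorm p)^-1 * x <= 1.
    move=> xp; have xe := le_trans xp (norm_le_enorm p).
    have [en|en] := eqVneq (enorm p) 0; first by rewrite en invr0 mul0r.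
    rewrite ler_pdivrMl ?mulr1 // lt_neqAle eq_sym en; exact: enorm_ge0.
  have [p1 p2] : p.1 <= `|p| /\ p.2 <= `|p|.
    by rewrite prod_normE !le_max !ler_norm orbT.
  have := ple1 _ p1; have := ple1 _ p2.
  have [h1|h1] := leP p.1 0; first by nra.
  have [h2|h2] := leP p.2 0; first by nra.
  by case: np.
Qed.

End Dent.

Theorem theorem1 (R : realType) (n : nat) (n_gt0 : (0 < n)%N) :
  exists gamma : set (R * R),
    [/\ simple_closed_curve gamma,
        inscribed_squares gamma #= `I_n,
        smooth_curve gamma &
        convex_curve gamma].
Proof.
have [e e0 gN] := dented_norm_gauge R n.
have circ t : dotp (cos t, sin t) (cos t, sin t) = 1 :> R.
  by rewrite /dotp /= -!expr2 cos2Dsin2.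
exists (gauge_curve (dented_norm n e)); split.
- exact: gauge_curve_simple_closed.
- rewrite inscribed_squaresE //.
  set S := [set u | _].
  have /card_eq_trans -> // : @central_square R @` S #= S.
    apply: inj_card_eq => u v; rewrite !inE => -[_ _ u1 u2] [_ _ v1 v2].
    exact: central_square_inj.
  pose v (i : nat) : R * R := (Num.sqrt (1 - (i%:R / n%:R) ^+ 2), i%:R / n%:R).
  have vinj : {in `I_n &, injective v}.
    move=> i j _ _ [_] /mulIf.
    rewrite invr_eq0 pnatr_eq0 -lt0n n_gt0 => /(_ isT) /eqP.
    by rewrite eqr_nat => /eqP.
  have -> : S = v @` `I_n; last exact: inj_card_eq.
  apply/seteqP; split=> [u [u1 Nu up uq]|_ [i ni <-]].
  + move: Nu; rewrite dented_norm_unit // => /eqP.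
    rewrite eq_sym addrC -subr_eq subrr eq_sym mulf_eq0 gt_eqF //= => /eqP.
    move/(dent_eq0 n_gt0 u1 up uq) => [i ni uE]; exists i => //.
    rewrite /v -uE [RHS]surjective_pairing; congr pair.
    rewrite -u1 /dotp expr2 addrK -expr2 sqrtr_sqr ger0_norm //.
    exact: ltW.
  + have n0 : 0 < n%:R :> R by rewrite ltr0n.
    have i0 : 0 <= i%:R / n%:R :> R by rewrite divr_ge0 // ltW.
    have i1 : i%:R / n%:R < 1 :> R by rewrite ltr_pdivrMr // mul1r ltr_nat.
    have s0 : 0 < 1 - (i%:R / n%:R) ^+ 2 :> R by nra.
    have v1 : dotp (v i) (v i) = 1.
      rewrite /dotp /v /= -!expr2 sqr_sqrtr; last exact: ltW.
      by rewrite subrK.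
    have vp : 0 < (v i).1 by rewrite /= sqrtr_gt0.
    split=> //; rewrite dented_norm_unit //.
    have -> : dent n (v i) = 0 by apply/dent_eq0 => //; exists i.
    by rewrite mulr0 addr0.
- apply: gauge_curve_smooth => //.
  have hs : smooth (fun t => 1 + e * dent n (cos t, sin t)).
    apply: smoothD; first exact: smooth_cst.
    by apply: smoothM (dent_smooth R n); exact: smooth_cst.
  rewrite (_ : (fun t => _) = fun t => 1 + e * dent n (cos t, sin t)) //.
  by apply/funext => t; exact: dented_norm_unit.
- exact: gauge_curve_convex.
Qed.
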